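(* Let $\mathcal{G}_t$ be the extended graph and let $u_i$ be an actuator with $\delta_r(u_i)\neq+\infty$. Let $\mathcal{X}_{u_i}$ be the set of all states $x_k\in\mathcal{X}$ for which there exists a directed path $u_i,x_j,\dots,x_k$ in $\mathcal{G}_t$ in which none of the states is adjacent to an actuator from $\mathcal{U}\setminus\{u_i\}$. Assume that a new sensor $y_l$ is placed to measure an arbitrary state from $\mathcal{X}_{u_i}$, and let $\delta_r'(u_i)$ be the robust index of $u_i$ after the placement. Then: (1) $\delta_r'(u_i)=+\infty$ if $y_l$ is protected; (2) $\delta_r'(u_i)=\delta_r(u_i)+1$ if $y_l$ is unprotected. Furthermore, assume that for every $x_j\in\mathcal{X}$ for which there exists an edge $(u_k,x_j)\in\mathcal{E}_{ux}$, there also exists an edge $(x_j,y_p)\in\mathcal{E}_{xy}$. Then $\delta_r(u_i)$ is increased (by placing a new sensor) if and only if the new sensor is placed to measure a state from $\mathcal{X}_{u_i}$.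
   Context: Structural model. $[A]\in\{0,1\}^{n_x\times n_x}$, $[B]\in\{0,1\}^{n_x\times n_u}$, $[C]\in\{0,1\}^{(n_y+n_e)\times n_x}$ with $[B]=[e_{i_1}\cdots e_{i_{n_u}}]$ of full column rank and $[C]=[e_{j_1}\cdots e_{j_{n_y+n_e}}]^T$, where $e_i$ are canonical basis vectors (each actuator influences one state, distinct actuators distinct states; each sensor measures one state). Graph. $\mathcal{X}=\{x_1,\dots,x_{n_x}\}$ (states), $\mathcal{U}=\{u_1,\dots,u_{n_u}\}$ (actuators), $\mathcal{Y}=\{y_1,\dots,y_{n_y+n_e}\}$ (sensors; $y_1,\dots,y_{n_y}$ unprotected, the last $n_e\ge0$ protected). $\mathcal{E}_{ux}=\{(u_j,x_i):[B](i,j)\ne0\}$, $\mathcal{E}_{xx}=\{(x_j,x_i):[A](i,j)\neq0\}$, $\mathcal{E}_{xy}=\{(x_j,y_i):[C](i,j)\ne0\}$. The extended graph $\mathcal{G}_t$ is the directed graph with nodes $\mathcal{X}\cup\mathcal{U}\cup\mathcal{Y}\cup\{t\}$ and edges $\mathcal{E}_{ux}\cup\mathcal{E}_{xx}\cup\mathcal{E}_{xy}\cup\{(y_i,t):y_i\in\mathcal{Y}\}$. Two nodes are adjacent if there is an edge between them. A vertex separator of non-adjacent nodes $v_a,v_b$ is a set of nodes not containing $v_a,v_b$ whose removal deletes all directed paths from $v_a$ to $v_b$. Robust security index. $\delta_r(u_i)$ is the minimum of $|\mathcal{U}_a|+|\mathcal{Y}_a|$ over $\mathcal{U}_a\subseteq\mathcal{U}$,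 $\mathcal{Y}_a\subseteq\mathcal{Y}$ such that $u_i\in\mathcal{U}_a$, all sensors in $\mathcal{Y}_a$ are unprotected, and $\mathcal{X}_a\cup\mathcal{Y}_a$ is a vertex separator of $u_i$ and $t$ in $\mathcal{G}_t$, where $\mathcal{X}_a=\{x_j\in\mathcal{X}:(u_k,x_j)\in\mathcal{E}_{ux},\ u_k\in\mathcal{U}_a\setminus\{u_i\}\}$. If no such pair exists, $\delta_r(u_i)=+\infty$. Placing a new sensor $y_l$ (protected or unprotected) to measure state $x$ means adding the node $y_l$ to $\mathcal{Y}$ and the edges $(x,y_l)$ and $(y_l,t)$ to the graph; the robust index after the placement is computed in the new graph. *)

(* Defs.v *)
From HB Require Import structures.
From mathcomp Require Import all_boot all_order all_algebra.
From mathcomp Require Import constructive_ereal.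

Set Implicit Arguments.
Unset Strict Implicit.
Unset Printing Implicit Defensive.

Import Order.TTheory GRing.Theory Num.Theory.

Section Digraph.
Variables (V : finType) (e : rel V).

Definition adjacent (a b : V) : bool := e a b || e b a.

Definition remove_nodes (S : {set V}) : rel V :=
  [rel x y | [&& x \notin S, y \notin S & e x y]].

Definition vertex_separator (a b : V) (S : {set V}) : bool :=
  [&& ~~ adjacent a b, a \notin S, b \notin S
    & ~~ connect (remove_nodes S) a b].

End Digraph.

Inductive node (X U Y : Type) : Type :=
  St of X | Act of U | Sen of Y | Tgt.
Arguments St {X U Y} x.
Arguments Act {X U Y} u.
Arguments Sen {X U Y} y.
Arguments Tgt {X U Y}.

Section NodeFinType.
Variables X U Y : finType.

Definition node_code (v : node X U Y) : (X + U) + (Y + unit) :=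
  match v with
  | St x => inl (inl x)
  | Act u => inl (inr u)
  | Sen y => inr (inl y)
  | Tgt => inr (inr tt)
  end.

Definition node_decode (s : (X + U) + (Y + unit)) : node X U Y :=
  match s with
  | inl (inl x) => St x
  | inl (inr u) => Act u
  | inr (inl y) => Sen y
  | inr (inr _) => Tgt
  end.

Lemma node_codeK : cancel node_code node_decode.
Proof. by case. Qed.

HB.instance Definition _ := Finite.copy (node X U Y) (can_type node_codeK).

End NodeFinType.

(* Actuators, states, sensors and the three edge families of the extended
   graph; the edges (y, t) are implicit since every sensor has one. *)
Record control_graph := ControlGraph {
  state : finType;
  actuator : finType;
  sensor : finType;
  E_ux : actuator -> state -> bool;
  E_xx : state -> state -> bool;
  E_xy : state -> sensor -> bool;
  protected : pred sensor
}.

Section ExtendedGraph.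
Variable G : control_graph.

Definition gnode := node (state G) (actuator G) (sensor G).

Definition edge : rel gnode := fun a b =>
  match a, b with
  | Act u, St x => E_ux u x
  | St x, St x' => E_xx x x'
  | St x, Sen y => E_xy x y
  | Sen _, Tgt => true
  | _, _ => false
  end.

(* The actuator u itself is excluded: its state does not enter the
   separator. *)
Definition attacked_states (u : actuator G) (Ua : {set actuator G}) :
    {set state G} :=
  [set x | [exists k in Ua :\ u, E_ux k x]].

Definition separating_pair (u : actuator G)
    (P : {set actuator G} * {set sensor G}) : bool :=
  [&& u \in P.1,
      [forall y in P.2, ~~ protected y]
    & vertex_separator edge (Act u) Tgt
        ((@St _ _ _ @: attacked_states u P.1) :|: (@Sen _ _ _ @: P.2))].

(* The values are natural numbers or +oo; -oo is never attained.  The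
   minimum over no pair is +oo. *)
Definition robust_index (u : actuator G) : \bar int :=
  \big[Order.min/+oo%E]_(P : {set actuator G} * {set sensor G}
                        | separating_pair u P) (#|P.1| + #|P.2|)%N%:Z%:E.

(* The states reached from u by a directed path none of whose states is
   adjacent to an actuator other than u. *)
Definition freely_reachable (u : actuator G) (x : state G) : Prop :=
  exists p : seq gnode,
    [/\ path edge (Act u) p,
        last (Act u) p = St x
      & forall (z : state G) (k : actuator G),
          St z \in p -> k != u -> ~~ adjacent edge (St z) (Act k)].

End ExtendedGraph.

(* The new sensor is None; it is protected iff b = true. *)
Definition add_sensor (G : control_graph) (x : state G) (b : bool) :
    control_graph :=
  {| state := state G;
     actuator := actuator G;
     sensor := option (sensor G);
     E_ux := @E_ux G;
     E_xx := @E_xx G;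
     E_xy := fun x' oy => if oy is Some y then E_xy x' y else x' == x;
     protected := fun oy => if oy is Some y then protected y else b |}.

Section StructuralModel.
Variables nx nu ny ne : nat.

(* The columns are canonical basis vectors; the 0/1 matrix is read over rat
   to speak of its rank. *)
Definition actuation_matrix (B : 'M[bool]_(nx, nu)) : Prop :=
  (exists i : 'I_nu -> 'I_nx, B = (\matrix_(k, j) (k == i j))%R) /\
  \rank (map_mx (fun b : bool => (b%:R : rat)%R) B) = nu.

Definition sensing_matrix (C : 'M[bool]_(ny + ne, nx)) : Prop :=
  exists j : 'I_(ny + ne) -> 'I_nx, C = (\matrix_(i, k) (k == j i))%R.

(* Entry (i, j) of a matrix is the edge from node j to node i; the last ne
   sensors are the protected ones. *)
Definition model_graph (A : 'M[bool]_nx) (B : 'M[bool]_(nx, nu))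
    (C : 'M[bool]_(ny + ne, nx)) : control_graph :=
  {| state := 'I_nx;
     actuator := 'I_nu;
     sensor := 'I_(ny + ne);
     E_ux := fun j i => B i j;
     E_xx := fun j i => A i j;
     E_xy := fun j i => C i j;
     protected := fun i => ny <= i |}.

End StructuralModel.

(* Main.v *)
(** An attack [(Ua, Ya)] separates [u] from the target iff every sensor of a
state reachable from [u] outside the attacked states lies in [Ya].  A freely
reachable state stays reachable whatever is attacked, so a sensor put on it
must be attacked as well: this is impossible if it is protected, and costs
exactly one more otherwise.  If [x] is not freely reachable but is reachable
under a given attack, some path to it meets a state [z] actuated by a [k] other
than [u] and not in [Ua]; a sensor [y] of [z] must then be in [Ya], and trading
[y] for [k] is again a separating attack of no larger size, because [y] measures
[z] only.  Iterating makes [x] unreachable, so a sensor on [x] changes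
nothing. *)
Require Import Defs.
From mathcomp Require Import all_boot all_order all_algebra.
From mathcomp Require Import constructive_ereal.

Set Implicit Arguments.
Unset Strict Implicit.
Unset Printing Implicit Defensive.

Import Order.TTheory GRing.Theory Num.Theory.

(** Turns connectivity after removal into ordinary paths avoiding [S], the form in which
    [freely_reachable] is given. The start is not an element of [p], hence the separate hypothesis
    on [a]. *)
Lemma connect_remove_nodesP (V : finType) (e : rel V) (S : {set V}) (a b : V) :
  a \notin S ->
  reflect (exists p, [/\ path e a p, last a p = b & {in p, forall v, v \notin S}])
          (connect (remove_nodes e S) a b).
Proof.
move=> aS; apply: (iffP connectP) => [[p + ->]|[p [+ <- pS]]].
  move=> pp; exists p; split=> //.
    by apply: sub_path pp => v w /and3P[].
  elim: p a {aS} pp => //= c p IH a /andP[/and3P[_ cS _] pp] v.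
  by rewrite inE => /predU1P[-> //|]; apply: IH pp v.
move=> pp; exists p => //.
elim: p a aS pp pS => //= c p IH a aS /andP[ac pp] pS.
have cS : c \notin S by apply: pS; rewrite inE eqxx.
apply/andP; split; first by apply/and3P.
by apply: IH => // v vp; apply: pS; rewrite inE vp orbT.
Qed.

Lemma cards_option (T : finType) (Y : {set option T}) :
  #|Y| = #|Some @^-1: Y| + (None \in Y).
Proof.
rewrite (cardsD1 None) addnC; congr (_ + _).
rewrite -(card_imset (Some @^-1: Y) (@Some_inj _)); apply: eq_card => -[y|].
  by rewrite mem_imset ?inE //; apply: Some_inj.
by rewrite !inE; case: imsetP => // -[].
Qed.

(** * States reachable from an actuator outside a set of attacked states *)

Section Reachability.
Variable G : control_graph.
Implicit Types (u k : actuator G) (D : {set state G}) (x z : state G).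
Implicit Types (Y : {set sensor G}).

(** Only [E_xx] is followed after the first step: no edge enters an actuator, and a sensor leads
    only to the target. The test [z0 \notin D] is explicit because [connect] is reflexive and would
    accept an attacked [z0] by the empty path. *)
Definition reach u D z : bool :=
  [exists z0, [&& E_ux u z0, z0 \notin D
                & connect (remove_nodes (@E_xx G) D) z0 z]].

Lemma reach_source u D z : E_ux u z -> z \notin D -> reach u D z.
Proof. by move=> uz zD; apply/existsP; exists z; rewrite uz zD connect0. Qed.

Lemma reach_notin u D z : reach u D z -> z \notin D.
Proof.
case/existsP=> z0 /and3P[_ zD /(connect_remove_nodesP _ _ zD)[p [_ <- pD]]].
by case: (lastP p) pD => [//|q w] pD; rewrite last_rcons pD // mem_rcons inE eqxx.
Qed.

Lemma reach_step u D z z' :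
  reach u D z -> E_xx z z' -> z' \notin D -> reach u D z'.
Proof.
move=> uz zz' z'D; have zD := reach_notin uz.
case/existsP: uz => z0 /and3P[uz0 z0D c]; apply/existsP; exists z0.
rewrite uz0 z0D (connect_trans c) //.
by apply: connect1; apply/and3P.
Qed.

Lemma reach_ind u D (Q : pred (state G)) :
  (forall z, E_ux u z -> z \notin D -> Q z) ->
  (forall z z', reach u D z -> Q z -> E_xx z z' -> z' \notin D -> Q z') ->
  forall z, reach u D z -> Q z.
Proof.
move=> Q0 QS z /existsP[z0 /and3P[uz0 z0D /connectP[p + ->]]].
have: reach u D z0 by apply: reach_source.
have: Q z0 by apply: Q0.
elim: p z0 {uz0 z0D} => //= c p IH z0 Qz0 rz0 /andP[/and3P[_ cD z0c]].
by apply: IH; [apply: (QS z0)|apply: (reach_step rz0)].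
Qed.

Lemma reach_subset u D D' z : D \subset D' -> reach u D' z -> reach u D z.
Proof.
move=> DD'; have nD w : w \notin D' -> w \notin D.
  by apply: contra; apply: (subsetP DD').
apply: reach_ind => [w uw /nD wD|w w' _ uw ww' /nD w'D].
  exact: reach_source.
exact: reach_step uw ww' w'D.
Qed.

(** If every state reachable outside [D] avoided [D'], the same walks would witness reachability
    outside [D'], by induction along them. *)
Lemma reach_crossing u D D' x :
  reach u D x -> ~~ reach u D' x -> exists2 z, z \in D' & reach u D z.
Proof.
move=> ux ux'; apply/exists_inP; move: ux'; apply: contraR => noz.
have nD' w : reach u D w -> w \notin D'.
  by move=> uw; apply: contra noz => wD'; apply/exists_inP; exists w.
move: x ux; apply: reach_ind => [z uz|z z' uz uz' zz'] zD.
  by apply: reach_source => //; apply: nD'; apply: reach_source.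
apply: (reach_step uz') => //; apply: nD'.
exact: reach_step zz' zD.
Qed.

Definition blocking D Y : {set gnode G} := (@St _ _ _ @: D) :|: (@Sen _ _ _ @: Y).

Lemma St_blocking D Y z : (St z \in blocking D Y) = (z \in D).
Proof.
rewrite inE mem_imset; last by move=> ? ? [].
by rewrite orbC; case: imsetP => // -[].
Qed.

Lemma Sen_blocking D Y y : (Sen y \in blocking D Y) = (y \in Y).
Proof.
rewrite inE orbC mem_imset; last by move=> ? ? [].
by rewrite orbC; case: imsetP => // -[].
Qed.

Lemma Act_blocking D Y k : Act k \notin blocking D Y.
Proof. by rewrite inE; apply/norP; split; apply/imsetP => -[]. Qed.

Lemma Tgt_blocking D Y : Tgt \notin blocking D Y.
Proof. by rewrite inE; apply/norP; split; apply/imsetP => -[]. Qed.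

(** The failure of separation in terms of states and sensors alone, with no path in the extended
    graph. *)
Definition leaks u D Y : bool :=
  [exists z, exists y, [&& reach u D z, E_xy z y & y \notin Y]].

(** Induction on the last edge of the path. All kinds of end node are treated at once, since the
    node before the last one may be of another kind. *)
Lemma connect_blocking u D Y (v : gnode G) :
  connect (remove_nodes (@edge G) (blocking D Y)) (Act u) v ->
  match v with
  | Act k => k == u
  | St z => reach u D z
  | Sen y => (y \notin Y) && [exists z, reach u D z && E_xy z y]
  | Tgt => leaks u D Y
  end.
Proof.
case/connectP => p; elim/last_ind: p v => [|p w IH] v /=; first by move=> _ ->.
rewrite rcons_path last_rcons => /andP[pp /and3P[_ + vw]] ->.
move: (IH _ pp erefl) vw; case: (last _ p) => [z|k|y|]; case: w => [z'|k'|y'|] //=.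
- by rewrite St_blocking => uz zz' z'D; apply: reach_step zz' z'D.
- rewrite Sen_blocking => uz zy yY; rewrite yY.
  by apply/existsP; exists z; rewrite uz.
- by move=> /eqP-> uz; rewrite St_blocking => zD; apply: reach_source.
- case/andP => yY /existsP[z /andP[uz zy]] _ _.
  by apply/existsP; exists z; apply/existsP; exists y; rewrite uz zy.
Qed.

Lemma connect_reach u D Y z :
  connect (remove_nodes (@edge G) (blocking D Y)) (Act u) (St z) = reach u D z.
Proof.
apply/idP/idP => [/connect_blocking //|]; move: z.
apply: reach_ind => [z uz zD|z z' uz cz zz' z'D].
  by apply: connect1; rewrite /remove_nodes /= Act_blocking St_blocking zD.
apply: connect_trans cz (connect1 _).
by rewrite /remove_nodes /= !St_blocking (reach_notin uz) z'D.
Qed.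

Lemma connect_leaks u D Y :
  connect (remove_nodes (@edge G) (blocking D Y)) (Act u) Tgt = leaks u D Y.
Proof.
apply/idP/idP => [/connect_blocking //|].
case/existsP => z /existsP[y /and3P[uz zy yY]].
have := uz; rewrite -(connect_reach _ _ Y) => /connect_trans; apply.
apply: (@connect_trans _ _ (Sen y)); apply: connect1; rewrite /remove_nodes /=.
  by rewrite St_blocking Sen_blocking (reach_notin uz) yY.
by rewrite Sen_blocking Tgt_blocking yY.
Qed.

(** * Separating attacks, free reachability and the exchange of a sensor for an actuator *)

Lemma separating_pairE u (Ua : {set actuator G}) Y :
  separating_pair u (Ua, Y) =
  [&& u \in Ua, [forall y in Y, ~~ protected y]
    & ~~ leaks u (attacked_states u Ua) Y].
Proof.
rewrite /separating_pair /vertex_separator /= -/(blocking _ Y).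
by rewrite Act_blocking Tgt_blocking connect_leaks.
Qed.

Lemma attacked_statesS u (Ua Ua' : {set actuator G}) :
  Ua \subset Ua' -> attacked_states u Ua \subset attacked_states u Ua'.
Proof.
move=> sU; apply/subsetP=> z; rewrite !inE => /exists_inP[k kU kz].
by apply/exists_inP; exists k => //; apply: subsetP kU; apply: setSD.
Qed.

(** Attacking all actuators removes exactly the states adjacent to an actuator other than [u],
    because adjacency to an actuator can only come from an edge of [E_ux]. *)
Lemma freely_reachableP u z :
  reflect (freely_reachable u z) (reach u (attacked_states u setT) z).
Proof.
(* With no sensor attacked, only states are forbidden on the path, as in [freely_reachable]. *)
rewrite -(connect_reach _ _ set0).
apply: (iffP (connect_remove_nodesP _ _ (Act_blocking _ _ _))).
  case=> p [pp pz pD]; exists p; split=> // x k xp ku.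
  have := pD _ xp; rewrite St_blocking inE; apply: contra.
  by rewrite /adjacent /= => kx; apply/exists_inP; exists k; rewrite ?inE ?ku.
case=> p [pp pz pD]; exists p; split=> // v vp.
case: v vp => [x|k|y|] vp; rewrite ?Act_blocking ?Tgt_blocking //.
  rewrite St_blocking inE; apply/exists_inP => -[k]; rewrite !inE andbT => ku kx.
  by have := pD x k vp ku; rewrite /adjacent /= kx.
by rewrite Sen_blocking inE.
Qed.

Lemma robust_index_le u P :
  separating_pair u P -> (robust_index u <= (#|P.1| + #|P.2|)%N%:Z%:E)%E.
Proof. exact: bigmin_le_cond. Qed.

Lemma robust_index_attained u :
  robust_index u <> +oo%E ->
  exists2 P, separating_pair u P & robust_index u = (#|P.1| + #|P.2|)%N%:Z%:E.
Proof.
move=> fin; case: (pickP (separating_pair u)) => [P sP|no]; last first.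
  by case: fin; rewrite /robust_index big_pred0.
have [Q sQ eQ] := eq_bigmin (x := +oo%E) P (separating_pair u)
  (fun P => (#|P.1| + #|P.2|)%N%:Z%:E) sP (fun _ _ => leey _).
by exists Q.
Qed.

(** Releasing [y] could only let [z] leak, and [z] is now attacked through [k]; enlarging the
    attacked states creates no other leak. *)
Lemma separating_exchange u k (Ua : {set actuator G}) Y z y :
  (forall z', E_xy z' y -> z' = z) ->
  separating_pair u (Ua, Y) -> k != u -> E_ux k z ->
  separating_pair u (k |: Ua, Y :\ y).
Proof.
move=> yz; rewrite !separating_pairE => /and3P[uU /forall_inP prY nl] ku kz.
apply/and3P; split; first by rewrite inE uU orbT.
  by apply/forall_inP => w /setD1P[_]; apply: prY.
apply: contra nl => /existsP[z' /existsP[y' /and3P[uz' zy' y'Y]]].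
apply/existsP; exists z'; apply/existsP; exists y'; rewrite zy' /=.
apply/andP; split.
  by apply: reach_subset uz'; apply: attacked_statesS; apply: subsetUr.
apply: contra y'Y => y'Y; rewrite !inE y'Y andbT.
apply: contraNneq (reach_notin uz') => y'y.
rewrite (yz z'); last by rewrite -y'y.
by rewrite inE; apply/exists_inP; exists k; rewrite // !inE ku eqxx.
Qed.

(** Each exchange removes one sensor from the attack and adds one actuator, so the number of
    attacked sensors is the induction measure and the total size does not grow. *)
Lemma separating_unreached u x (P : {set actuator G} * {set sensor G}) :
  (forall y z z', E_xy z y -> E_xy z' y -> z = z') ->
  (forall z, (exists k, E_ux k z) -> exists y, E_xy z y) ->
  ~ freely_reachable u x -> separating_pair u P ->
  exists Q, [/\ separating_pair u Q, #|Q.1| + #|Q.2| <= #|P.1| + #|P.2|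
              & ~~ reach u (attacked_states u Q.1) x].
Proof.
move=> one obs nfree; have [n] := ubnP #|P.2|.
elim: n P => // n IH [Ua Y] /= ltn sP.
have [ux|] := boolP (reach u (attacked_states u Ua) x); last by exists (Ua, Y).
(* As [x] is not freely reachable, some state reached under the present attack is driven by an
   actuator other than [u]. *)
have [|z] := reach_crossing ux (D' := attacked_states u setT).
  by apply/freely_reachableP.
rewrite inE => /exists_inP[k /setD1P[ku _] kz] uz.
have [y zy] := obs z (ex_intro _ k kz).
have yY : y \in Y.
  move: sP; rewrite separating_pairE => /and3P[_ _]; apply: contraR => yY.
  by apply/existsP; exists z; apply/existsP; exists y; rewrite uz zy.
(* Otherwise [z] would be attacked already and could not be reached. *)
have kU : k \notin Ua.
  apply: contra (reach_notin uz) => kU.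
  by rewrite inE; apply/exists_inP; exists k => //; apply/setD1P.
have := separating_exchange (fun z' zy' => one _ _ _ zy' zy) sP ku kz.
move: ltn; rewrite (cardsD1 y Y) yY add1n => ltn /(IH (k |: Ua, Y :\ y) ltn).
case=> Q [sQ leQ uQ]; exists Q; split=> //; apply: leq_trans leQ _.
by rewrite cardsU1 kU addnS.
Qed.

End Reachability.

(** * Effect of a new sensor on separating attacks and on the index *)

Section AddSensor.
Variables (G : control_graph) (u : actuator G) (x : state G).
Implicit Types (b : bool) (Ua : {set actuator G}).

Lemma leaks_add_sensor b (D : {set state G}) (Y : {set option (sensor G)}) :
  leaks (G := add_sensor x b) u D Y =
  leaks u D (Some @^-1: Y) || (reach u D x && (None \notin Y)).
Proof.
apply/existsP/orP => [[z /existsP[[y|] /and3P[uz zy yY]]]|[]].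
- left; apply/existsP; exists z; apply/existsP; exists y; apply/and3P; split=> //.
  by rewrite inE.
- by right; rewrite -(eqP zy) yY andbT.
- case/existsP=> z /existsP[y /and3P[uz zy]]; rewrite inE => yY.
  by exists z; apply/existsP; exists (Some y); apply/and3P.
- case/andP=> ux nY; exists x; apply/existsP; exists None; apply/and3P.
  by split=> //=.
Qed.

(** Reduces the new graph to the old one. Reachability of states ignores sensors, so the new sensor
    only adds the leak through [x] and its own protection constraint. *)
Lemma separating_add_sensor b Ua (Y : {set option (sensor G)}) :
  separating_pair (G := add_sensor x b) u (Ua, Y) =
  [&& separating_pair u (Ua, Some @^-1: Y), (None \in Y) ==> ~~ b
    & reach u (attacked_states u Ua) x ==> (None \in Y)].
Proof.
rewrite !separating_pairE.
have -> : leaks (G := add_sensor x b) u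
    (attacked_states (G := add_sensor x b) u Ua) Y = _ := leaks_add_sensor b _ Y.
have -> : [forall y in Y, ~~ protected (c := add_sensor x b) y] =
    [forall y in Some @^-1: Y, ~~ protected y] && ((None \in Y) ==> ~~ b).
  apply/forall_inP/andP => [pr|[/forall_inP pr nb] [y|] yY].
  - split; last by apply/implyP => /pr.
    by apply/forall_inP => y; rewrite inE => /pr.
  - by apply: pr; rewrite inE.
  - exact: (implyP nb).
rewrite negb_or negb_and negbK -implybE.
case: (u \in Ua) => //=; case: [forall y in _, _] => //=.
by case: (leaks _ _ _); rewrite ?andbF.
Qed.

(** Every attack leaves [x] reachable, since [setT] attacks the most states; the new sensor would
    have to be attacked, which its protection forbids. *)
Lemma robust_index_add_protected :
  reach u (attacked_states u setT) x ->
  robust_index (G := add_sensor x true) u = +oo%E.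
Proof.
move=> ux; rewrite /robust_index big_pred0 // => -[Ua Y].
rewrite separating_add_sensor.
rewrite (reach_subset _ ux) ?attacked_statesS ?subsetT //=.
by case: (None \in Y); rewrite !andbF.
Qed.

Lemma robust_index_add_unprotected :
  reach u (attacked_states u setT) x -> robust_index u <> +oo%E ->
  robust_index (G := add_sensor x false) u = (robust_index u + 1%:E)%E.
Proof.
move=> ux /robust_index_attained[[Ua Y] sP eP].
apply/eqP; rewrite eq_le; apply/andP; split.
  (* Upper bound: an optimal old attack, extended by the new sensor. *)
  set Y' := None |: Some @: Y.
  have Y'E : Some @^-1: Y' = Y.
    by apply/setP => y; rewrite !inE /= mem_imset //; apply: Some_inj.
  have s' : separating_pair (G := add_sensor x false) u (Ua, Y').
    by rewrite separating_add_sensor Y'E sP setU11 implybT.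
  apply: le_trans (robust_index_le s') _; rewrite eP /=.
  by rewrite cards_option Y'E setU11 addnA -EFinD lee_fin PoszD.
(* Lower bound: a new attack must contain the new sensor, and dropping it leaves an attack on the
   old graph. *)
apply/bigmin_geP; split=> [|[Ua' Y']]; first exact: leey.
rewrite separating_add_sensor => /and3P[s' _].
rewrite (reach_subset _ ux) ?attacked_statesS ?subsetT //= => nY'.
rewrite cards_option nY' addnA PoszD EFinD leeD2rE //.
exact: robust_index_le s'.
Qed.

(** Any old attack can be replaced, at no greater cost, by one under which [x] is unreachable. That
    one still separates without attacking the new sensor, so the value of [b] is irrelevant. *)
Lemma robust_index_add_le b :
  (forall y (z z' : state G), E_xy z y -> E_xy z' y -> z = z') ->
  (forall z : state G, (exists k, E_ux k z) -> exists y, E_xy z y) ->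
  ~ freely_reachable u x ->
  (robust_index (G := add_sensor x b) u <= robust_index u)%E.
Proof.
move=> one obs nfree; apply/bigmin_geP; split=> [|P sP]; first exact: leey.
have [[Ua Y] [sQ leQ uQ]] := separating_unreached one obs nfree sP.
have nY : None \notin (Some @: Y) by apply/imsetP => -[].
have YE : Some @^-1: (Some @: Y) = Y.
  by apply/setP => y; rewrite !inE mem_imset //; apply: Some_inj.
have s' : separating_pair (G := add_sensor x b) u (Ua, Some @: Y).
  by rewrite separating_add_sensor YE sQ (negbTE nY) (negbTE uQ).
apply: le_trans (robust_index_le s') _.
by rewrite /= cards_option YE (negbTE nY) addn0 lee_fin lez_nat.
Qed.

End AddSensor.

Theorem theorem3 (nx nu ny ne : nat) (A : 'M[bool]_nx)
    (B : 'M[bool]_(nx, nu)) (C : 'M[bool]_(ny + ne, nx)) (u : 'I_nu)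
    (hB : actuation_matrix B) (hC : sensing_matrix C) :
  let G := model_graph A B C in
  @robust_index G u <> +oo%E ->
  (forall x : state G, @freely_reachable G u x ->
     @robust_index (add_sensor x true) u = +oo%E /\
     @robust_index (add_sensor x false) u = (@robust_index G u + 1%:E)%E) /\
  ((forall x : state G, (exists k : actuator G, E_ux k x) ->
      exists y : sensor G, E_xy x y) ->
   forall (x : state G) (b : bool),
     (@robust_index G u < @robust_index (add_sensor x b) u)%E <->
     @freely_reachable G u x).
Proof.
move=> G fin.
have part1 (x : state G) : @freely_reachable G u x ->
     @robust_index (add_sensor x true) u = +oo%E /\
     @robust_index (add_sensor x false) u = (@robust_index G u + 1%:E)%E.
  move/freely_reachableP => ux.
  by split; [apply: robust_index_add_protected|apply: robust_index_add_unprotected].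
split=> // obs x b; split=> [|/part1[pr unpr]].
  rewrite ltNge => lt; apply/freely_reachableP; apply: contraNT lt => nox.
  apply: robust_index_add_le => //; last by move/freely_reachableP; apply/negP.
  (* Each row of [C] is a canonical basis vector, so a sensor measures a single state. *)
  by case: hC => j Cj y z z'; rewrite /= Cj !mxE => /eqP-> /eqP->.
(* The old index is an integer, so both [+oo] and the increment by one are strictly larger. *)
have [P _ eP] := robust_index_attained fin.
case: b; rewrite ?pr ?unpr eP; first exact: ltry.
by rewrite -EFinD lte_fin ltrDl.
Qed.
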